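(* Let $d\geq 1$ and $\Theta\in\{\max,\min,\mathrm{prod}\}$, and if $\Theta=\max$ assume $d\leq 2$. Then the function \[ \psi(q)=\begin{cases} q^{-2} & \Theta=\max \text{ or } \Theta=\min,\\ q^{-2/d} & \Theta=\mathrm{prod}\end{cases} \] is uniformly Dirichlet and optimally Dirichlet on $\mathbb{R}^d$ with respect to the height function $H_\Theta$.
   Context: Let $\|\cdot\|$ be the max norm on $\mathbb{R}^d$. For $\Theta:\mathbb{N}^d\to\mathbb{N}$, $H_\Theta:\mathbb{Q}^d\to\mathbb{N}$ is $H_\Theta(p_1/q_1,\ldots,p_d/q_d)=\Theta(q_1,\ldots,q_d)$ with each $p_i/q_i$ in reduced form, $q_i\geq1$; $\max,\min,\mathrm{prod}$ denote the maximum, minimum and product of the $d$ arguments. For a height function $H$, a function $\psi:\mathbb{N}\to(0,\infty)$ and $\mathbf{x}\in\mathbb{R}^d$, let $C_{H,\psi}(\mathbf{x})=\liminf_{\mathbf{r}\in\mathbb{Q}^d,\ \mathbf{r}\to\mathbf{x}}\frac{\|\mathbf{x}-\mathbf{r}\|}{\psi(H(\mathbf{r}))}$. The function $\psi$ is Dirichlet on $\mathbb{R}^d$ with respect to $H$ if $C_{H,\psi}(\mathbf{x})<\infty$ for all $\mathbf{x}\in\mathbb{R}^d\setminus\mathbb{Q}^d$; uniformly Dirichlet if $\sup_{\mathbb{R}^d\setminus\mathbb{Q}^d}C_{H,\psi}<\infty$; optimally Dirichlet if it is Dirichlet and $C_{H,\psi}(\mathbf{x})>0$ for at least one $\mathbf{x}\in\mathbb{R}^d\setminus\mathbb{Q}^d$.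 (If $\psi$ is only defined for large arguments, extend it arbitrarily to $\mathbb{N}$.) *)

(* Defs.v *)
From HB Require Import structures.
From mathcomp Require Import all_boot all_order all_algebra.
From mathcomp Require Import all_classical all_reals all_analysis.

Set Implicit Arguments.
Unset Strict Implicit.
Unset Printing Implicit Defensive.

Import Order.TTheory GRing.Theory Num.Theory.
Import numFieldNormedType.Exports.

Local Open Scope classical_set_scope.
Local Open Scope ring_scope.

Definition theta_max (d : nat) (q : 'I_d -> nat) : nat := \max_(i < d) q i.

(* The minimum of the q i when 0 < d: the neutral element chosen here is an
   upper bound of all the q i. *)
Definition theta_min (d : nat) (q : 'I_d -> nat) : nat :=
  \big[minn/theta_max q]_(i < d) q i.

Definition theta_prod (d : nat) (q : 'I_d -> nat) : nat := (\prod_(i < d) q i)%N.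

Variant theta_kind := ThetaMax | ThetaMin | ThetaProd.

Definition Theta (d : nat) (k : theta_kind) : ('I_d -> nat) -> nat :=
  match k with
  | ThetaMax => @theta_max d
  | ThetaMin => @theta_min d
  | ThetaProd => @theta_prod d
  end.

Definition height (d : nat) (theta : ('I_d -> nat) -> nat) (r : 'rV[rat]_d) : nat :=
  theta (fun i => `|denq (r ord0 i)|%N).

Definition rat_point (R : realType) (d : nat) (r : 'rV[rat]_d) : 'rV[R]_d :=
  map_mx ratr r.

Definition irrational_points (R : realType) (d : nat) : set 'rV[R]_d :=
  ~` range (@rat_point R d).

(* The liminf as r tends to x within Q^d: the supremum, over the neighbourhoods
   A of x, of the infimum over the rational points of A. It is spelled out as in
   limf_einfE because rat carries no topology in the library.
   The norm that the library puts on 'rV[R]_d is the max norm. The functions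
   psi are only evaluated at values of H, which are positive integers for the
   heights above when 0 < d, so the value psi 0 is irrelevant. *)
Definition approx_const (R : realType) (d : nat) (H : 'rV[rat]_d -> nat)
    (psi : nat -> R) (x : 'rV[R]_d) : \bar R :=
  ereal_sup
    [set ereal_inf [set (`|x - rat_point R r| / psi (H r))%:E
                   | r in @rat_point R d @^-1` A]
    | A in nbhs x].

Definition dirichlet (R : realType) (d : nat) (H : 'rV[rat]_d -> nat)
    (psi : nat -> R) : Prop :=
  forall x : 'rV[R]_d, irrational_points x -> (approx_const H psi x < +oo)%E.

Definition uniformly_dirichlet (R : realType) (d : nat)
    (H : 'rV[rat]_d -> nat) (psi : nat -> R) : Prop :=
  (ereal_sup [set approx_const H psi x | x in @irrational_points R d] < +oo)%E.

Definition optimally_dirichlet (R : realType) (d : nat)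
    (H : 'rV[rat]_d -> nat) (psi : nat -> R) : Prop :=
  dirichlet H psi /\
  exists x : 'rV[R]_d, irrational_points x /\ (0 < approx_const H psi x)%E.

Definition psi_theta (R : realType) (d : nat) (k : theta_kind) (q : nat) : R :=
  match k with
  | ThetaMax | ThetaMin => q%:R ^- 2
  | ThetaProd => q%:R `^ (- (2 / d%:R))
  end.

(* Main.v *)
Require Import Defs.
From HB Require Import structures.
From mathcomp Require Import all_boot all_order all_algebra.
From mathcomp Require Import all_classical all_reals all_analysis.
From mathcomp Require Import zify ring lra.

(** For a real [x], best approximations yield rationals [r_j] with
    [|x - r_j| <= 4^-j] and denominators at most [q_j], where [q] is
    nondecreasing and [q_j * q_{j+1} <= 4^(j+1)] whenever [q] changes at [j].
    Put [f_j = log2 q_j - j]: it drops by 1 at each step, except at a change,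
    where [|f_{j+1}| <= 1 - f_j].  Given such a sequence for each coordinate of
    a point, it is enough to find infinitely many [j] for which the height
    built from the [q_j] is small:
    - for the maximum of two coordinates (and hence also for the minimum), both
      [f]'s are bounded above by 2 infinitely often, because the ratio of the
      larger to the smaller denominator drops by a factor 4 each time the two
      exchange their roles;
    - for the product, the sum over the coordinates of [f_j ^ 2] decreases as
      long as the mean of the [f_j] exceeds 1.
    Optimality is witnessed by the point all of whose coordinates are
    [sqrt 2]. *)

Set Implicit Arguments.
Unset Strict Implicit.
Unset Printing Implicit Defensive.

Import Order.TTheory GRing.Theory Num.Theory.
Import numFieldNormedType.Exports.

Local Open Scope classical_set_scope.
Local Open Scope ring_scope.

(** * Slow sequences of denominators, and pairs of them *)

Section SlowSequences.
Local Open Scope nat_scope.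

Definition slow (q : nat -> nat) : Prop :=
  [/\ forall j, 0 < q j, forall j, q j <= q j.+1 &
      forall j, q j.+1 = q j \/ q j * q j.+1 <= 4 ^ j.+1].

Lemma slow_le q i j : slow q -> i <= j -> q i <= q j.
Proof.
move=> [_ qS _] /subnK <-; elim: (j - i) => [|k IH]; first exact: leqnn.
exact: leq_trans IH (qS _).
Qed.

Lemma slow_mul_le q i j : slow q -> i <= j -> q j = q i \/ q i * q j <= 4 ^ j.
Proof.
move=> sq /subnK <-; elim: (j - i) => [|k IH]; first by left.
have [_ _ /(_ (k + i))] := sq; rewrite addSn => -[->|le4].
  case: IH => [->|le4]; [by left|right].
  by apply: leq_trans le4 _; rewrite leq_exp2l.
right; apply: leq_trans le4; rewrite leq_mul2r (slow_le sq) ?orbT //.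
exact: leq_addl.
Qed.

(** A change at [j] would give [q j ^ 2 <= q j * q j.+1 <= 4 ^ j.+1]. *)
Lemma slow_const q j : slow q -> 2 ^ j.+1 < q j -> q j.+1 = q j.
Proof.
move=> [_ qS q4] q_gt; case: (q4 j) => // le4; exfalso.
have : (2 ^ j.+1) ^ 2 < 4 ^ j.+1.
  apply: leq_trans le4; rewrite -mulnn.
  by have := qS j; move: (2 ^ _) q_gt => e; nia.
by rewrite -expnM mulnC expnM ltnn.
Qed.

(** Above the threshold [4 * 2 ^ j] the sequence is frozen while the threshold doubles, so the
    threshold catches up. *)
Lemma slow_hit q j : slow q ->  4 * 2 ^ j < q j ->
  exists k, [/\ j <= k, q k.+1 = q j, 4 * 2 ^ k < q j & q j <= 4 * 2 ^ k.+1].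
Proof.
move=> sq; have [n] := ubnP (q j - 4 * 2 ^ j).
elim: n j => // n IH j lt_n q_gt.
have qS : q j.+1 = q j by apply: slow_const => //; rewrite expnS; lia.
case: (leqP (q j) (4 * 2 ^ j.+1)) => [le|gt]; first by exists j.
have [||k [jk qk gtk lek]] := IH j.+1.
- by have := expn_gt0 2 j; rewrite qS; move: gt; rewrite expnS; lia.
- by rewrite qS.
by exists k; rewrite -qS; split => //; apply: ltnW.
Qed.

(* The larger denominator stays constant until it becomes admissible; if the
   other one is not admissible then, it has overtaken, and the ratio of the
   larger to the smaller has dropped by a factor 4. *)
Lemma slow_pair_descent n q s j : slow q -> slow s ->
  4 * 2 ^ j < q j -> s j <= q j -> q j <= 4 ^ n * s j ->
  exists2 k, j <= k & q k <= 4 * 2 ^ k /\ s k <= 4 * 2 ^ k.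
Proof.
elim: n q s j => [|n IH] q s j sq ss q_gt le_sq le_qs;
  have [k [jk qk gtk lek]] := slow_hit sq q_gt;
  have jk1 : j <= k.+1 by [exact: leqW];
  have [sk|sk] := leqP (s k.+1) (4 * 2 ^ k.+1);
  try (by exists k.+1; rewrite ?qk);
  (* [s] has changed since [j], because [s k.+1 > 4 * 2 ^ k.+1 >= q j >= s j]. *)
  have [|mul4] := slow_mul_le ss jk1; try lia;
  have sq4 : 4 ^ k.+1 * 4 < q j * q j.
- have -> : 4 ^ k.+1 = 2 ^ k.+1 * 2 ^ k.+1 by rewrite -expnMn.
  by rewrite expnS; nia.
- by exfalso; nia.
- have -> : 4 ^ k.+1 = 2 ^ k.+1 * 2 ^ k.+1 by rewrite -expnMn.
  by rewrite expnS; nia.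
have [] := IH s q k.+1 ss sq sk.
- by rewrite qk; lia.
- rewrite qk.
  have sj0 : 0 < s j by have [] := ss.
  have : s j * s k.+1 * 4 < 4 ^ n.+1 * s j * q j.
    apply: leq_ltn_trans (_ : 4 ^ k.+1 * 4 < _); first by rewrite leq_mul2r mul4 orbT.
    by apply: leq_trans sq4 _; rewrite leq_mul2r le_qs orbT.
  by rewrite expnS; move: (4 ^ n) => m; nia.
by move=> i ki [si qi]; exists i => //; apply: leq_trans ki.
Qed.

Lemma slow_pair_small q s j : slow q -> slow s ->
  exists2 k, j <= k & q k <= 4 * 2 ^ k /\ s k <= 4 * 2 ^ k.
Proof.
move=> sq ss.
wlog le_sq : q s sq ss / s j <= q j.
  move=> H; case: (leqP (s j) (q j)) => [|/ltnW] le; first exact: H.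
  by have [k jk []] := H s q ss sq le; exists k.
have [le|gt] := leqP (q j) (4 * 2 ^ j).
  by exists j => //; split => //; apply: leq_trans le_sq le.
(* Any bound on the ratio will do; [q j <= 4 ^ q j] is a crude one. *)
apply: (slow_pair_descent (n := q j)) => //.
apply: leq_trans (ltnW (ltn_expl (q j) (isT : 1 < 4))) _.
by rewrite leq_pmulr //; have [] := ss.
Qed.

End SlowSequences.

(** * Rational approximation of one real number *)

(** Induction on the order: the mediant replaces the neighbour on its side of [x] once its
    denominator reaches the new order. *)
Lemma farey_neighbours (R : realType) (x : R) (N : nat) : (0 < N)%N ->
  exists (a c : int) (b d : nat),
  [/\ (0 < b <= N)%N, (0 < d <= N)%N, (N < b + d)%N,
      a%:~R <= b%:R * x /\ d%:R * x <= c%:~R &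
      c%:~R * b%:R - a%:~R * d%:R = 1 :> R].
Proof.
elim: N => // -[_ _|N IH _].
  exists (Num.floor x), (Num.floor x + 1), 1%N, 1%N; split => //.
  - by rewrite !mul1r floor_le ltW // floorD1_gt.
  - by rewrite rmorphD /=; ring.
have [a [c [b [d [/andP[b0 bN] /andP[d0 dN] Nbd [ax xc] det]]]]] := IH isT.
have [lt|ge] := ltnP N.+2 (b + d)%N.
  by exists a, c, b, d; split => //; lia.
have [le|gt] := leP (a + c)%:~R ((b + d)%:R * x).
  exists (a + c), c, (b + d)%N, d; split => //; try lia.
  by rewrite -[RHS]det intrD natrD; ring.
exists a, (a + c), b, (b + d)%N; split => //; try lia.
  by split => //; apply: ltW.
by rewrite -[RHS]det intrD natrD; ring.
Qed.

(** For Farey neighbours, [b * (c - d * x) + d * (b * x - a) = 1], so the smaller error is at most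
    [1 / (b + d)], and [N.+1 <= b + d]. *)
Lemma dirichlet_sharp (R : realType) (x : R) (N : nat) : (0 < N)%N ->
  exists (q : nat) (p : int),
    (0 < q <= N)%N /\ `|q%:R * x - p%:~R| * N.+1%:R <= 1.
Proof.
move=> /(farey_neighbours x) [a [c [b [d [bN dN Nbd [ax xc] det]]]]].
have N1 : N.+1%:R <= b%:R + d%:R :> R by rewrite -natrD ler_nat.
have b0 : 0 <= b%:R :> R by [].
have d0 : 0 <= d%:R :> R by [].
have [le|gt] := leP (b%:R * x - a%:~R) (c%:~R - d%:R * x).
  exists b, a; split => //; rewrite ger0_norm ?subr_ge0 //.
  by move: (N.+1%:R : R) N1 => n; nra.
exists d, c; split => //; rewrite distrC ger0_norm ?subr_ge0 //.
by move: (N.+1%:R : R) N1 => n; nra.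
Qed.

Definition best_approx (R : realType) (x : R) (q : nat) (p : int) : Prop :=
  forall (q' : nat) (p' : int), (0 < q' < q)%N ->
    `|q%:R * x - p%:~R| <= `|q'%:R * x - p'%:~R|.

(** If [q] is not precise enough for [M], let [q'] be the least denominator with error at most
    [q / M]. Dirichlet gives [q' <= M %/ q], minimality makes it a best approximation, and [q' < q]
    would contradict that [q] is one. *)
Lemma best_approx_step (R : realType) (x : R) (q : nat) (p : int) (M : nat) :
  (0 < q)%N -> (0 < M)%N -> best_approx x q p ->
  exists (q' : nat) (p' : int),
    [/\ (q <= q')%N, best_approx x q' p',
        `|q'%:R * x - p'%:~R| * M%:R <= q'%:R &
        q' = q \/ (q * q' <= M)%N].
Proof.
move=> q0 M0 bq.
have [le|gt] := leP (`|q%:R * x - p%:~R| * M%:R) q%:R.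
  by exists q, p; split => //; left.
(* If [M < q], comparison with denominator 1 bounds the error by 1, so [q] would be precise
   enough. *)
have qM : (q <= M)%N.
  rewrite leqNgt; apply/negP => Mq; move: gt; rewrite ltNge => /negP; apply.
  have q1 : (0 < 1 < q)%N by lia.
  have := bq _ (Num.floor x) q1; rewrite mul1r => /le_trans H.
  have le1 : `|q%:R * x - p%:~R| <= 1.
    apply: H; have := floor_itv x => /andP[]; rewrite intrD => f1 f2.
    by rewrite ger0_norm; lra.
  apply: le_trans (_ : M%:R <= _); last by rewrite ler_nat ltnW.
  by rewrite ler_piMl.
pose P n := (0 < n)%N && `[< exists p', `|n%:R * x - p'%:~R| * M%:R <= q%:R >].
have N0 : (0 < M %/ q)%N by rewrite divn_gt0.
have [n [r [/andP[n0 nN] nr]]] := dirichlet_sharp x N0.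
have Pn : P n.
  rewrite /P n0; apply/asboolP; exists r.
  (* The successor in [dirichlet_sharp] matters here: [M < (M %/ q).+1 * q]. *)
  have := ltn_ceil M q0; rewrite -(ltr_nat R) natrM => Mlt.
  apply: (@le_trans _ _ (`|n%:R * x - r%:~R| * ((M %/ q).+1%:R * q%:R))).
    by rewrite ler_wpM2l // ltW.
  by rewrite mulrA ler_piMl.
have [q' /andP[q'0 /asboolP[p' q'p']] q'min] := ex_minnP (ex_intro P n Pn).
have qq' : (q <= q')%N.
  rewrite leqNgt; apply/negP => lt.
  move: gt; rewrite ltNge => /negP; apply; apply: le_trans q'p'.
  by rewrite ler_wpM2r // bq // q'0.
exists q', p'; split => //.
- move=> q2 p2 /andP[q20 q2lt].
  rewrite leNgt; apply/negP => lt.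
  have : P q2.
    rewrite /P q20; apply/asboolP; exists p2; apply: le_trans q'p'.
    by rewrite ler_wpM2r // ltW.
  by move/q'min; rewrite leqNgt q2lt.
- by apply: le_trans q'p' _; rewrite ler_nat.
right; rewrite mulnC -leq_divRL //; exact: leq_trans (q'min _ Pn) nN.
Qed.

Lemma denq_divq_le (p : int) (q : nat) :
  (0 < q)%N -> (`|denq (p%:~R / q%:R)| <= q)%N.
Proof.
move=> q0; have -> : p%:~R / q%:R = fracq (p, q%:Z) by rewrite fracqE.
rewrite den_fracq /=.
case: eqP => [|_]; first by move=> [] ?; lia.
exact: leq_div.
Qed.

Lemma slow_approx (R : realType) (x : R) :
  exists (r : nat -> rat) (q : nat -> nat), slow q /\
    forall j, (`|denq (r j)| <= q j)%N /\ `|x - ratr (r j)| <= 4 ^- j.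
Proof.
pose good (j : nat) (s : nat * int) := [/\ (0 < s.1)%N, best_approx x s.1 s.2 &
  `|s.1%:R * x - s.2%:~R| * (4 ^ j)%:R <= s.1%:R].
(* Being conditional on [good], [next] can be satisfied at every pair, with a dummy value where
   [good] fails; this is what [choice] requires. *)
pose next (js : nat * (nat * int)) (s' : nat * int) := good js.1 js.2 ->
  [/\ good js.1.+1 s', (js.2.1 <= s'.1)%N &
      s'.1 = js.2.1 \/ (js.2.1 * s'.1 <= 4 ^ js.1.+1)%N].
have [F FP] : {F & forall js, next js (F js)}.
  apply: choice => -[j [q p]].
  have [[q0 bq e]|n] := pselect (good j (q, p)); last by exists (0%N, 0).
  have [//||//|q' [p' [qq' b' e' m']]] := @best_approx_step R x q p (4 ^ j.+1).
    by rewrite expn_gt0.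
  by exists (q', p') => _; split => //; split => //=; apply: leq_trans qq'.
pose s := nat_rect (fun=> (nat * int)%type) (1%N, Num.floor x) (fun j t => F (j, t)).
have gs j : good j (s j).
  elim: j => [|j /(FP (j, s j)) []//]; split => //=.
    by move=> q' p' /=; lia.
  have := floor_itv x => /andP[]; rewrite intrD => f1 f2.
  by rewrite mul1r expn0 mulr1 ger0_norm; lra.
exists (fun j => (s j).2%:~R / (s j).1%:R), (fun j => (s j).1); split.
  split=> j; first by have [] := gs j.
    by have [] := FP (j, s j) (gs j).
  by have [] := FP (j, s j) (gs j).
move=> j; have [q0 _ e] := gs j; split; first exact: denq_divq_le.
have q0R : 0 < (s j).1%:R :> R by rewrite ltr0n.
rewrite fmorph_div /= ratr_int ratr_nat.
rewrite -(ler_pM2l q0R) -[X in X * _ <= _](ger0_norm (ltW q0R)) -normrM.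
rewrite mulrBr mulrCA divff ?gt_eqF // mulr1.
by rewrite ler_pdivlMr ?exprn_gt0 // -natrX.
Qed.

(** * Products of slow sequences *)

Lemma ln_prod_natr (R : realType) (d : nat) (q : 'I_d -> nat) :
  (forall i, (0 < q i)%N) ->
  ln ((\prod_(i < d) q i)%N%:R) = \sum_(i < d) ln (q i)%:R :> R.
Proof.
move=> q0.
suff [] : (0 < \prod_(i < d) q i)%N /\
  ln ((\prod_(i < d) q i)%N%:R) = \sum_(i < d) ln (q i)%:R :> R by [].
elim/big_rec2: _ => [|i y n _ [n0 e]]; first by rewrite ln1.
split; first by rewrite muln_gt0 q0.
by rewrite natrM lnM ?e // posrE ltr0n.
Qed.

Section SlowProduct.
Variables (R : realType) (d : nat) (q : 'I_d -> nat -> nat).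
Hypotheses (d_gt0 : (0 < d)%N) (slow_q : forall i, slow (q i)).

Let L : R := ln 2.
(** With natural logarithms, this is [L] times the f of the overview. *)
Let f i j : R := ln (q i j)%:R - j%:R * L.
Let V j : R := \sum_(i < d) f i j ^+ 2.

Let L_gt0 : 0 < L. Proof. by rewrite ln_gt0 // ltr1n. Qed.

Let q_gt0 i j : (0 < q i j)%N. Proof. by have [] := slow_q i. Qed.

(** Without a change, equality holds. At a change, monotonicity and the product bound give
    [f i j - L <= f i j.+1 <= L - f i j]. *)
Let f_step i j : f i j.+1 ^+ 2 <= (f i j - L) ^+ 2.
Proof.
have posq k : (q i k)%:R \is @Num.pos R by rewrite posrE ltr0n.
rewrite /f -natr1.
have [_ /(_ j) le_q /(_ j)[->|le4]] := slow_q i.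
  by rewrite le_eqVlt; apply/orP; left; apply/eqP; ring.
have le1 : ln (q i j)%:R <= ln (q i j.+1)%:R :> R by rewrite ler_ln // ler_nat.
have le2 : ln (q i j)%:R + ln (q i j.+1)%:R <= 2 * ((j%:R + 1) * L).
  rewrite -lnM // -natrM natr1 /L mulrA -natrM mulr_natl -lnXn //.
  rewrite ler_ln ?posrE ?ltr0n ?muln_gt0 ?q_gt0 ?exprn_gt0 //.
  by rewrite -natrX ler_nat expnM.
set u := ln (q i j)%:R - _; set v := ln _ - _.
have h1 : u - L <= v by rewrite /u /v; lra.
have h2 : u - L <= - v by rewrite /u /v; lra.
by nra.
Qed.

(** The hypothesis says that the [f i j] sum to more than [d * L]; expand the squares
    [(f i j - L) ^ 2]. *)
Let V_step j : (2 ^ (j.+1 * d) < \prod_(i < d) q i j)%N ->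
  V j.+1 <= V j - d%:R * L ^+ 2.
Proof.
move=> big.
have sumf : d%:R * L <= \sum_(i < d) f i j.
  rewrite /f big_split /= sumr_const card_ord -ln_prod_natr //.
  have : ln ((2 ^ (j.+1 * d))%:R : R) <= ln ((\prod_(i < d) q i j)%N%:R).
    rewrite ler_ln ?posrE ?ltr0n ?expn_gt0 //; last exact: leq_ltn_trans big.
    by rewrite ler_nat ltnW.
  rewrite natrX lnXn // -/L -[L *+ _]mulr_natl natrM -natr1 -mulr_natl.
  by move: (ln _) => a; lra.
apply: le_trans (_ : \sum_(i < d) (f i j - L) ^+ 2 <= _).
  by apply: ler_sum => i _; apply: f_step.
rewrite (eq_bigr (fun i => f i j ^+ 2 + ((- 2 * L) * f i j + L ^+ 2))); last first.
  by move=> i _; ring.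
rewrite big_split /= lerD2l big_split /= sumr_const card_ord -mulr_sumr.
rewrite -[_ *+ d]mulr_natl; have := ler_wpM2l (ltW L_gt0) sumf.
by move: (\sum_(i < d) _) => S; lra.
Qed.

(* [V] is bounded below, so it cannot decrease by a fixed amount forever. *)
Lemma slow_prod_small j0 :
  exists2 j, (j0 <= j)%N & (\prod_(i < d) q i j <= (2 ^ j.+1) ^ d)%N.
Proof.
apply: contrapT => none.
have big j : (j0 <= j)%N -> (2 ^ (j.+1 * d) < \prod_(i < d) q i j)%N.
  move=> j0j; rewrite ltnNge; apply/negP => le; apply: none; exists j => //.
  by rewrite -expnM.
have V_le n : V (j0 + n)%N <= V j0 - n%:R * (d%:R * L ^+ 2).
  elim: n => [|n IH]; first by rewrite addn0 mul0r subr0.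
  rewrite addnS; apply: le_trans (V_step (big _ (leq_addr _ _))) _.
  by rewrite -natr1; lra.
have c0 : 0 < d%:R * L ^+ 2 by rewrite mulr_gt0 ?ltr0n ?exprn_gt0.
have V0 j : 0 <= V j by apply: sumr_ge0 => i _; apply: sqr_ge0.
have := archi_boundP (divr_ge0 (V0 j0) (ltW c0)).
rewrite ltr_pdivrMr //; set n := Num.Def.archi_bound _ => lt.
by have := V_le n; have := V0 (j0 + n)%N; lra.
Qed.

End SlowProduct.

(** * Bad approximability of the square root of 2 *)

(** The 2-adic valuations have different parities. *)
Lemma sqr_neq_double_sqr (p q : nat) : (0 < q)%N -> (p ^ 2 != 2 * q ^ 2)%N.
Proof.
move=> q0; apply/eqP => /(congr1 (fun n => odd (logn 2 n))).
by rewrite lognM ?expn_gt0 ?q0 // !lognX (pfactorK 1) //= !oddM.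
Qed.

(** With [r = p / q], the nonzero integer [2 * q ^ 2 - p ^ 2] factors as
    [q ^ 2 * (s - r) * (s + r)], and [|s + r| <= 4] when [|s - r| < 1]. *)
Lemma sqrt2_badly_approximable (R : realType) (r : rat) :
  4^-1 * (`|denq r|%N%:R ^- 2) <= `|Num.sqrt 2 - ratr r| :> R.
Proof.
set s := Num.sqrt 2 : R.
have s2 : s * s = 2 by rewrite -expr2 sqr_sqrtr.
have s0 : 0 <= s by apply: sqrtr_ge0.
have s32 : s <= 3 / 2 by nra.
set q := `|denq r|%N; have q0 : (0 < q)%N by rewrite absz_gt0 denq_neq0.
have qR : 1 <= q%:R :> R by rewrite ler1n.
have qE : (denq r)%:~R = q%:R :> R by rewrite -[denq r]gtz0_abs ?denq_gt0.
set p : R := (numq r)%:~R.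
have yq : ratr r * q%:R = p.
  by rewrite /ratr qE divfK // gt_eqF // ltr0n.
have pq : 1 <= `|2 * q%:R ^+ 2 - p ^+ 2|.
  have -> : 2 * q%:R ^+ 2 - p ^+ 2 = (2 * denq r ^+ 2 - numq r ^+ 2)%:~R.
    by rewrite rmorphB rmorphM !rmorphXn /= qE.
  rewrite -intr_norm -[1]/(1%:~R) ler_int -gtz0_ge1 normr_gt0 subr_eq0.
  apply/eqP => /(congr1 absz); rewrite abszM !abszX => /esym/eqP.
  by rewrite (negbTE (sqr_neq_double_sqr _ _)).
set e := `|s - ratr r|.
have e0 : 0 <= e by apply: normr_ge0.
rewrite ler_pdivrMr ?exprn_gt0 ?ltr0n //.
have [e1|e1] := leP 1 e; first by nra.
have : 1 <= e * `|s + ratr r| * q%:R ^+ 2.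
  rewrite /e -normrM -[q%:R ^+ 2]ger0_norm ?sqr_ge0 // -normrM.
  apply: le_trans pq _; rewrite -yq le_eqVlt; apply/orP; left; apply/eqP.
  by congr `|_|; rewrite -s2; ring.
have : `|s + ratr r| <= 4.
  have -> : s + ratr r = 2 * s - (s - ratr r) by ring.
  apply: le_trans (ler_normB _ _) _; rewrite -/e ger0_norm; lra.
have : 0 <= `|s + ratr r| by [].
move: (`|s + _|) (q%:R) qR => u v v1 u0 u4 H.
suff : e * u * v ^+ 2 <= e * 4 * v ^+ 2 by lra.
by rewrite ler_wpM2r ?sqr_ge0 // ler_wpM2l.
Qed.

(** * Heights and the functions [psi_theta] *)

Lemma theta_min_le (d : nat) (q : 'I_d -> nat) i : (theta_min q <= q i)%N.
Proof.
rewrite /theta_min; have : i \in index_enum 'I_d by rewrite mem_index_enum.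
elim: (index_enum _) => // j s IH; rewrite inE big_cons geq_min.
by move=> /orP[/eqP ->|/IH ->]; rewrite ?leqnn ?orbT.
Qed.

(* The bound on a height which makes [psi_theta] at least [n ^- 2]. *)
Definition height_cap (d : nat) (k : theta_kind) (n : nat) : nat :=
  if k is ThetaProd then (n ^ d)%N else n.

(** The index of the least [q i] serves all three heights. Optimality is thereby reduced to a single
    coordinate. *)
Lemma Theta_ge (d : nat) (k : theta_kind) (q : 'I_d -> nat) : (0 < d)%N ->
  exists i, (height_cap d k (q i) <= Theta k q)%N.
Proof.
move=> d0; have [i _ le_q] := @arg_minnP _ (Ordinal d0) xpredT q isT.
exists i; case: k => /=; first exact: leq_bigmax.
  rewrite /theta_min; elim/big_ind: _ => [|m n *|j _]; first exact: leq_bigmax.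
    by rewrite leq_min; apply/andP.
  exact: le_q.
rewrite /theta_prod -[d in (_ ^ d)%N]card_ord -prod_nat_const.
by apply: leq_prod => j _; apply: le_q.
Qed.

Lemma height_gt0 (d : nat) (k : theta_kind) (r : 'rV[rat]_d) :
  (0 < d)%N -> (0 < height (@Theta d k) r)%N.
Proof.
move=> d0; have [i] := Theta_ge k (fun i => `|denq (r ord0 i)|%N) d0.
apply: leq_trans; rewrite /height_cap; case: k => //=;
  by rewrite ?expn_gt0 absz_gt0 denq_neq0.
Qed.

Lemma psi_theta_cap (R : realType) (d : nat) (k : theta_kind) (n : nat) :
  (0 < d)%N -> psi_theta R d k (height_cap d k n) = n%:R ^- 2.
Proof.
move=> d0; case: k => //=.
rewrite powRN natrX -powR_mulrn // -powRrM mulrCA divff ?mulr1 ?powR_mulrn //.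
by rewrite pnatr_eq0 -lt0n.
Qed.

Lemma psi_theta_le (R : realType) (d : nat) (k : theta_kind) (m n : nat) :
  (0 < m <= n)%N -> psi_theta R d k n <= psi_theta R d k m.
Proof.
move=> /andP[m0 mn]; have n0 := leq_trans m0 mn.
case: k => /=; rewrite ?powRN lef_pV2 ?posrE ?exprn_gt0 ?powR_gt0 ?ltr0n //.
- by rewrite lerXn2r ?nnegrE ?ler_nat.
- by rewrite lerXn2r ?nnegrE ?ler_nat.
- by apply: ge0_ler_powR; rewrite ?nnegrE ?ler_nat ?divr_ge0.
Qed.

Lemma psi_theta_gt0 (R : realType) (d : nat) (k : theta_kind) (n : nat) :
  (0 < n)%N -> 0 < psi_theta R d k n.
Proof.
by move=> n0; case: k => /=; rewrite ?invr_gt0 ?exprn_gt0 ?powR_gt0 ?ltr0n.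
Qed.

(** * The max norm and bounds on the approximation constant *)

Lemma coord_le_mx_norm (R : realType) (d : nat) (v : 'rV[R]_d) i :
  `|v ord0 i| <= `|v|.
Proof.
by rewrite /Num.norm /= mx_normrE; apply: (le_bigmax _ _ (ord0, i)).
Qed.

Lemma mx_norm_le (R : realType) (d : nat) (v : 'rV[R]_d) (e : R) :
  0 <= e -> (forall i, `|v ord0 i| <= e) -> `|v| <= e.
Proof.
move=> e0 le_e; rewrite /Num.norm /= mx_normrE; apply: bigmax_le => //=.
by move=> [i j] _ /=; rewrite (ord1 i).
Qed.

Lemma small_height_approx (R : realType) (d : nat) (k : theta_kind)
    (x : 'rV[R]_d) (j0 : nat) :
  (0 < d)%N -> (k = ThetaMax -> (d <= 2)%N) ->
  exists (j : nat) (r : 'rV[rat]_d),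
    [/\ (j0 <= j)%N, `|x - rat_point R r| <= 4 ^- j &
        (height (@Theta d k) r <= height_cap d k (4 * 2 ^ j))%N].
Proof.
move=> d0 d2.
have [r rP] := choice (fun i : 'I_d => slow_approx (x ord0 i)).
have [q qP] := choice rP.
have slow_q i : slow (q i) by have [] := qP i.
have close j : `|x - rat_point R (\row_i r i j)| <= 4 ^- j.
  apply: mx_norm_le => [|i]; first by rewrite invr_ge0 exprn_ge0.
  by rewrite !mxE; have [_ /(_ j)[]] := qP i.
have den j i : (`|denq ((\row_i r i j) ord0 i)| <= q i j)%N.
  by rewrite mxE; have [_ /(_ j)[]] := qP i.
suff [j j0j le] : exists2 j, (j0 <= j)%N &
  (height (@Theta d k) (\row_i r i j) <= height_cap d k (4 * 2 ^ j))%N.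
  by exists j, (\row_i r i j).
pose i0 := Ordinal d0.
case: k d2 => [d2|_|_].
(* The last index: it equals [i0] if [d = 1], and is the other index if [d = 2]. *)
- pose i1 : 'I_d := Ordinal (etrans (ltn_predL d) d0).
  have [j j0j [le0 le1]] := slow_pair_small j0 (slow_q i0) (slow_q i1).
  exists j => //; apply/bigmax_leqP => i _; apply: leq_trans (den j i) _.
  have [->//|->//] : i = i0 \/ i = i1.
  have := d2 erefl; case: i => m /= md dle; case: m md => [|m] md.
    by left; apply: val_inj.
  by right; apply: val_inj => /=; lia.
(* One coordinate bounds the minimum, so the pair consists of one sequence taken twice. *)
- have [j j0j [le0 _]] := slow_pair_small j0 (slow_q i0) (slow_q i0).
  exists j => //; apply: leq_trans (theta_min_le _ i0) _.
  exact: leq_trans (den j i0) le0.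
- have [j j0j le] := slow_prod_small R d0 slow_q j0.
  exists j => //; rewrite /height /= /theta_prod.
  apply: leq_trans (_ : \prod_(i < d) q i j <= _)%N; first exact: leq_prod.
  apply: leq_trans le _; rewrite leq_exp2r // expnS.
  by rewrite leq_mul2r orbT.
Qed.

(** Every neighbourhood contains a point at distance at most [4 ^- j] where [psi_theta] is at least
    [(4 * 2 ^ j) ^- 2 = 4 ^- j / 16]. *)
Lemma approx_const_le (R : realType) (d : nat) (k : theta_kind) (x : 'rV[R]_d) :
  (0 < d)%N -> (k = ThetaMax -> (d <= 2)%N) ->
  (approx_const (height (@Theta d k)) (@psi_theta R d k) x <= 16%:E)%E.
Proof.
move=> d0 d2; apply: ge_ereal_sup => _ [A /nbhs_ballP[e e0 eA] <-].
have [j0 lt_e] : exists j0, e^-1 < j0%:R.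
  by exists (Num.bound e^-1); apply: archi_boundP; rewrite invr_ge0 ltW.
have [j [r [j0j close le_h]]] := small_height_approx x j0 d0 d2.
have lt_j : 4 ^- j < e.
  rewrite invf_plt ?posrE ?exprn_gt0 //; apply: lt_trans lt_e _.
  by rewrite -natrX ltr_nat; apply: leq_ltn_trans j0j _; apply: ltn_expl.
have h0 := height_gt0 k r d0.
apply: ge_ereal_inf; exists (`|x - rat_point R r| /
   psi_theta R d k (height (@Theta d k) r))%:E.
  exists r => //=; apply: eA; rewrite mx_norm_ball /ball_ /=.
  exact: le_lt_trans close lt_j.
rewrite lee_fin ler_pdivrMr ?psi_theta_gt0 //; apply: le_trans close _.
have := @psi_theta_le R d k _ _ (introT andP (conj h0 le_h)).
rewrite psi_theta_cap // => le_psi.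
rewrite -ler_pdivrMl //; apply: le_trans le_psi.
have sq2 : 2 ^+ 2 = 4 :> R by ring.
have sq4 : 4 ^+ 2 = 16 :> R by ring.
by rewrite natrM natrX exprMn exprAC sq2 sq4 invfM.
Qed.

Lemma irrational_sqrt2 (R : realType) (d : nat) : (0 < d)%N ->
  irrational_points (const_mx (Num.sqrt 2) : 'rV[R]_d).
Proof.
move=> d0 [r _ /matrixP /(_ ord0 (Ordinal d0))]; rewrite !mxE => e.
have := sqrt2_badly_approximable R (r ord0 (Ordinal d0)).
rewrite e subrr normr0 leNgt => /negP; apply.
by rewrite mulr_gt0 ?invr_gt0 ?exprn_gt0 // ltr0n absz_gt0 denq_neq0.
Qed.

Lemma approx_const_sqrt2 (R : realType) (d : nat) (k : theta_kind) : (0 < d)%N ->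
  (4^-1%:E <= approx_const (height (@Theta d k)) (@psi_theta R d k)
                (const_mx (Num.sqrt 2) : 'rV[R]_d))%E.
Proof.
move=> d0; apply: le_ereal_sup_tmp.
(* The lower bound holds at all rational points, so the whole space serves as neighbourhood. *)
eexists; first by exists setT => //; exact: filterT.
apply: le_ereal_inf_tmp => _ [r _ <-].
rewrite lee_fin ler_pdivlMr ?psi_theta_gt0 ?height_gt0 //.
have [i le_i] := Theta_ge k (fun i => `|denq (r ord0 i)|%N) d0.
apply: le_trans (coord_le_mx_norm _ i); rewrite !mxE.
apply: le_trans (sqrt2_badly_approximable R (r ord0 i)).
rewrite ler_wpM2l ?invr_ge0 // -(psi_theta_cap R k _ d0).
apply: psi_theta_le; rewrite le_i andbT.
by case: (k) => /=; rewrite ?expn_gt0 absz_gt0 denq_neq0.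
Qed.

Theorem theorem1p2 (R : realType) (d : nat) (k : theta_kind) :
  (1 <= d)%N ->
  (k = ThetaMax -> (d <= 2)%N) ->
  uniformly_dirichlet (height (@Theta d k)) (@psi_theta R d k) /\
  optimally_dirichlet (height (@Theta d k)) (@psi_theta R d k).
Proof.
move=> d0 d2; have le16 x := @approx_const_le R d k x d0 d2.
split; first apply: le_lt_trans (_ : 16%:E < _)%E.
- by apply: ge_ereal_sup => _ [x _ <-].
- exact: ltry.
split=> [x _|]; first exact: le_lt_trans (le16 x) (ltry _).
exists (const_mx (Num.sqrt 2)); split; first exact: irrational_sqrt2.
apply: lt_le_trans (approx_const_sqrt2 R k d0).
by rewrite lte_fin invr_gt0.
Qed.
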